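(* Let $f\in C_B^{r}[0,\infty)$ and $r\in\mathbb{N}_0$. Then for $n>r$ and $x\in(0,\infty)$, we have $$\left|\frac{1}{b(n,k,r)}M_{n,k}^{(r)}(f;x)-f^{(r)}(x)\right|\le C\,\omega_2\!\left(f^{(r)},\gamma_n\right)+\omega\!\left(f^{(r)},\frac{2r-k+1}{n-r}x\right),$$ where $C$ is an absolute constant and $$\gamma_n=\left(\frac{4r^{2}+4r(2-k)+2n+k^{2}-5k+4}{(n-r)(n-r-1)}x^{2}+\left(\frac{2r-k+1}{n-r}x\right)^{2}\right)^{1/2}.$$
   Context: $\mathbb{N}_0$ denotes the set of non-negative integers. For $n,k\in\mathbb{N}$ with $n\ge k$, the general Gamma type operators are $$M_{n,k}(f;x)=\frac{(2n-k+1)!\,x^{n+1}}{n!\,(n-k)!}\int_0^\infty \frac{t^{n-k}}{(x+t)^{2n-k+2}}f(t)\,dt,\qquad x>0.$$ $M_{n,k}^{(r)}(f;x)$ denotes the $r$-th derivative of $M_{n,k}(f;x)$ with respect to $x$ (with $M_{n,k}^{(0)}=M_{n,k}$), and $$b(n,k,r)=\frac{(n-r)!\,(n-k+r)!}{n!\,(n-k)!}.$$ $C_B[0,\infty)$ is the space of all real-valued continuous and bounded functions on $[0,\infty)$ endowed with the supremum norm, and $C_B^{r}[0,\infty)$ is the space of all $f\in C_B[0,\infty)$ such that $f',f'',\dots,f^{(r)}\in C_B[0,\infty)$ (for $r=0$ it is $C_B[0,\infty)$). The first order modulus of continuity $\omega$ and the second order modulus of smoothness $\omega_2$ are $$\omega(g,\delta)=\sup_{0<h\le\delta}\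 \sup_{y\in[0,\infty)}|g(y+h)-g(y)|,\qquad \omega_2(g,\delta)=\sup_{0<h\le\delta}\ \sup_{y\in[0,\infty)}|g(y+2h)-2g(y+h)+g(y)|.$$
   Formalization: The argument of ω is taken in absolute value, since (2r−k+1)x/(n−r) is negative for k>2r+1 and the bound then fails as written; for n=r+1, where γ_n has a zero denominator, γ_n is read as +∞. *)

(* Defs.v *)
From mathcomp Require Import all_boot all_order all_algebra.
From mathcomp Require Import all_classical all_reals all_analysis.

Set Implicit Arguments.
Unset Strict Implicit.
Unset Printing Implicit Defensive.

Import Order.TTheory GRing.Theory Num.Theory.
Import numFieldNormedType.Exports.

Local Open Scope classical_set_scope.
Local Open Scope ring_scope.

(* A function on [0, +oo[ is represented by a function R -> R; everything below
   only looks at its values on [0, +oo[ when evaluated at points of [0, +oo[. *)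

(* The difference quotient is restricted to x + h >= 0: this is the usual
   derivative for x > 0 and the right derivative for x = 0. *)
Definition half_quotient {R : realType} (f : R -> R) (x h : R) : R :=
  h^-1 *: (f (h + x) - f x).

Definition half_derivable {R : realType} (f : R -> R) (x : R) : Prop :=
  cvg (half_quotient f x @ within [set h | 0 <= h + x] 0^').

Definition half_derive {R : realType} (f : R -> R) (x : R) : R :=
  lim (half_quotient f x @ within [set h | 0 <= h + x] 0^').

Definition half_deriven {R : realType} (r : nat) (f : R -> R) : R -> R :=
  iter r half_derive f.

Definition CB {R : realType} (f : R -> R) : Prop :=
  {within `[0, +oo[, continuous f} /\
  exists B : R, forall x : R, 0 <= x -> `|f x| <= B.

Definition CBn {R : realType} (r : nat) (f : R -> R) : Prop :=
  (forall i, (i <= r)%N -> CB (half_deriven i f)) /\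
  (forall i, (i < r)%N -> forall x : R, 0 <= x ->
     half_derivable (half_deriven i f) x).

(* The natural-number subtractions are exact for k <= n. *)
Definition gammaop {R : realType} (n k : nat) (f : R -> R) (x : R) : R :=
  (2 * n - k + 1)`!%:R * x ^+ n.+1 / (n`!%:R * (n - k)`!%:R) *
  \int[lebesgue_measure]_(t in `[0, +oo[)
     (t ^+ (n - k) / (x + t) ^+ (2 * n - k + 2) * f t).

(* The natural-number subtractions are exact for k <= n and r <= n. *)
Definition bcoef {R : realType} (n k r : nat) : R :=
  ((n - r)`!%:R * (n - k + r)`!%:R) / (n`!%:R * (n - k)`!%:R).

(* [sup] of the empty set is 0, so that omega g 0 = 0 and omega2 g 0 = 0. *)
Definition omega {R : realType} (g : R -> R) (delta : R) : R :=
  sup [set sup [set `|g (y + h) - g y| | y in `[0, +oo[]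
      | h in [set h | 0 < h <= delta]].

(* The step bound may be +oo, in which case h ranges over all of ]0, +oo[. *)
Definition omega2 {R : realType} (g : R -> R) (delta : \bar R) : R :=
  sup [set sup [set `|g (y + 2 * h) - 2 * g (y + h) + g y| | y in `[0, +oo[]
      | h in [set h | 0 < h /\ (h%:E <= delta)%E]].

(* First moment about x of the normalised r-th derivative operator; the
   subtractions are in R, and the value is negative when k > 2 r + 1. *)
Definition drift {R : realType} (n k r : nat) (x : R) : R :=
  (2 * r%:R - k%:R + 1) / (n%:R - r%:R) * x.

Definition gamma_num {R : realType} (n k r : nat) : R :=
  4 * r%:R ^+ 2 + 4 * r%:R * (2 - k%:R) + 2 * n%:R + k%:R ^+ 2 - 5 * k%:R + 4.

(* Computed in \bar R, where 0^-1 = +oo: for n = r + 1 the denominator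
   vanishes, the numerator is positive (it is (n - k + r + 1) (n - k + r + 2)),
   and gamman = +oo.  For n > r + 1 the value is finite. *)
Definition gamman {R : realType} (n k r : nat) (x : R) : \bar R :=
  sqrte ((gamma_num n k r)%:E / ((n%:R - r%:R) * (n%:R - r%:R - 1))%:E
           * (x ^+ 2)%:E + (drift n k r x ^+ 2)%:E)%E.

(* Main.v *)
Require Import Defs.
From mathcomp Require Import all_boot all_order all_algebra.
From mathcomp Require Import all_classical all_reals all_analysis measurable_realfun.
From mathcomp Require Import ring lra zify.
Set Implicit Arguments.
Unset Strict Implicit.
Unset Printing Implicit Defensive.

Import Order.TTheory GRing.Theory Num.Theory.
Import numFieldNormedType.Exports.
Local Open Scope classical_set_scope.
Local Open Scope ring_scope.

(* The substitution t = x s turns M_{n,k}(f; x) into a multiple of the integral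
   of f(x s) against s^(n-k) / (1+s)^(2n-k+2), so that its r-th derivative is
   obtained by differentiating under the integral sign:
   M^(r)(f; x) / b(n,k,r) = E g(Y), where g = f^(r), Y = x S and S has the beta
   prime distribution with parameters n-k+r+1 and n-r+1.  Its mean is
   E Y = x + drift, and gamma_n^2 = Var Y + 2 drift^2.  The term
   |g(E Y) - g(x)| is at most omega(g, |drift|).  For |E g(Y) - g(E Y)|, no
   smoothing of g is needed: if all second differences of g with step at most d
   are bounded by w, then g differs from the affine function interpolating it at
   m and m + d by at most 4 w (1 + ((y - m) / d)^2), and one integrates this with
   m = E Y and d = gamma_n, which gives C = 8.  When n = r + 1 the variance is
   infinite; letting d tend to infinity gives |g(y) - g(m)| <= 4 w pointwise. *)

(** * Second differences and the distance to an affine interpolant *)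

(** Summation twice: consecutive increments differ by at most [w], so the j-th one is at most
    [(4 + j) * w], and adding these up stays below the quadratic. The bound on [s 1] is guarded by
    [0 < J] because, in the walk to the left of m, the point behind [s 1] could otherwise be
    negative. *)
Lemma second_difference_growth (R : realType) (s : nat -> R) (w : R) (J : nat) :
  0 <= w -> `|s 0| <= 2 * w -> ((0 < J)%N -> `|s 1 - s 0| <= 4 * w) ->
  (forall j, (j.+2 <= J)%N -> `|s j.+2 - 2 * s j.+1 + s j| <= w) ->
  `|s J| <= (2 + 4 * J%:R + J%:R ^+ 2) * w.
Proof.
move=> w0 s0 s1 s2.
have ds j : (j < J)%N -> `|s j.+1 - s j| <= (4 + j%:R) * w.
  elim: j => [|j IHj] jJ; first by rewrite addr0; exact: s1.
  have := IHj (ltnW jJ); have := s2 _ jJ; rewrite -natr1 !ler_norml.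
  by move=> /andP[? ?] /andP[? ?]; apply/andP; split; lra.
suff {s1 s2} H j : (j <= J)%N -> `|s j| <= (2 + 4 * j%:R + j%:R ^+ 2) * w by exact: H.
elim: j => [|j IHj] jJ; first by rewrite mulr0 expr0n !addr0.
have := IHj (ltnW jJ); have := ds _ jJ; rewrite -natr1 !ler_norml.
have : 0 <= j%:R * w by rewrite mulr_ge0.
by move=> ? /andP[? ?] /andP[? ?]; apply/andP; split; nra.
Qed.

(** Subtracting an affine function leaves second differences unchanged. The remainder phi is at most
    w on [m, m + d], hence at most 2 w one step beyond on either side; from a base point within d of
    m, y is then reached by floor(|y - m| / d) steps of length d. *)
Lemma second_difference_affine (R : realType) (g : R -> R) (B w d m : R) :
  (forall y, 0 <= y -> `|g y| <= B) -> 0 < d -> 0 <= m ->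
  (forall y h, 0 <= y -> 0 < h <= d ->
    `|g (y + 2 * h) - 2 * g (y + h) + g y| <= w) ->
  forall y, 0 <= y -> `|g y - g m - (g (m + d) - g m) / d * (y - m)| <=
    4 * w * (1 + ((y - m) / d) ^+ 2).
Proof.
move=> gB d0 m0 g2.
have w0 : 0 <= w by apply: le_trans (g2 0 d _ _); rewrite ?d0 ?lexx.
pose a := (g (m + d) - g m) / d; pose phi y := g y - g m - a * (y - m).
have phi2 y h : 0 <= y -> 0 < h <= d ->
    `|phi (y + 2 * h) - 2 * phi (y + h) + phi y| <= w.
  move=> y0 h0; have := g2 y h y0 h0.
  by congr (`|_| <= _); rewrite /phi; ring.
have phim : phi m = 0 by rewrite /phi; ring.
have phid : phi (m + d) = 0 by rewrite /phi /a; field; lra.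
(* phi vanishes at m and m + d; a second difference centred at a point of
   [m, m + d] and starting at the nearer end gives 2 sup|phi| <= w + sup|phi|. *)
have phi01 y : m <= y <= m + d -> `|phi y| <= w.
  pose A := [set `|phi y| | y in `[m, m + d]].
  have supA : has_sup A.
    split; first by exists `|phi m|, m => //=; rewrite in_itv/= lexx lerDl ltW.
    exists (B + B + `|a| * d) => _ [z/= + <-]; rewrite in_itv/= => /andP[mz zd].
    rewrite (le_trans (ler_normB _ _))// lerD//.
      by rewrite (le_trans (ler_normB _ _))// lerD// gB// (le_trans m0).
    by rewrite normrM ler_wpM2l// ger0_norm; lra.
  move=> ymd; have yA : A `|phi y| by exists y => //=; rewrite in_itv.
  have : `|phi y| <= sup A by exact: sup_upper_bound.
  suff : sup A <= (w + sup A) / 2 by lra.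
  apply: ge_sup; first by case: supA.
  move=> _ [z/= + <-]; rewrite in_itv/= => /andP[mz zd].
  have le_sup t : m <= t <= m + d -> `|phi t| <= sup A.
    by move=> ht; apply: sup_upper_bound => //; exists t => //=; rewrite in_itv.
  have [->|zm] := eqVneq z m.
    rewrite phim normr0 divr_ge0// addr_ge0// (le_trans (normr_ge0 (phi m)))//.
    by rewrite le_sup// lexx lerDl ltW.
  have {mz zm} mz : m < z by rewrite lt_neqAle eq_sym zm.
  have [zh|zh] := leP (z - m) (d / 2).
    have := phi2 m (z - m) m0 ltac:(lra); rewrite phim.
    have -> : m + 2 * (z - m) = 2 * z - m by ring.
    have -> : m + (z - m) = z by ring.
    have := le_sup (2 * z - m) ltac:(lra).
    rewrite !ler_norml => /andP[? ?] /andP[? ?]; apply/andP; split; lra.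
  have [->|zmd] := eqVneq z (m + d).
    rewrite phid normr0 divr_ge0// addr_ge0// (le_trans (normr_ge0 (phi m)))//.
    by rewrite le_sup// lexx lerDl ltW.
  have {zd zmd} zd : z < m + d by rewrite lt_neqAle zmd.
  have := phi2 (2 * z - (m + d)) (m + d - z) ltac:(lra) ltac:(lra).
  have -> : 2 * z - (m + d) + 2 * (m + d - z) = m + d by ring.
  have -> : 2 * z - (m + d) + (m + d - z) = z by ring.
  rewrite phid.
  have := le_sup (2 * z - (m + d)) ltac:(lra).
  rewrite !ler_norml => /andP[? ?] /andP[? ?]; apply/andP; split; lra.
(* phi vanishes at m + d, so the second difference centred there compares y with its mirror image in
   [m, m + d], which gives w + w. [phiN] mirrors in m in the same way. *)
have phi12 y : m + d <= y <= m + 2 * d -> `|phi y| <= 2 * w.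
  move=> /andP[y1 y2]; have [->|ymd] := eqVneq y (m + d).
    by rewrite phid normr0 mulr_ge0.
  have {ymd}y1 : m + d < y by rewrite lt_neqAle eq_sym ymd.
  have := phi2 (2 * (m + d) - y) (y - (m + d)) ltac:(lra) ltac:(lra).
  have -> : 2 * (m + d) - y + 2 * (y - (m + d)) = y by ring.
  have -> : 2 * (m + d) - y + (y - (m + d)) = m + d by ring.
  rewrite phid.
  have := phi01 (2 * (m + d) - y) ltac:(lra).
  rewrite !ler_norml => /andP[? ?] /andP[? ?]; apply/andP; split; lra.
have phiN y : 0 <= y -> m - d <= y <= m -> `|phi y| <= 2 * w.
  move=> y0 /andP[y1 y2]; have [->|ym] := eqVneq y m.
    by rewrite phim normr0 mulr_ge0.
  have {ym}y2 : y < m by rewrite lt_neqAle ym.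
  have := phi2 y (m - y) y0 ltac:(lra).
  have -> : y + 2 * (m - y) = 2 * m - y by ring.
  have -> : y + (m - y) = m by ring.
  rewrite phim.
  have := phi01 (2 * m - y) ltac:(lra).
  rewrite !ler_norml => /andP[? ?] /andP[? ?]; apply/andP; split; lra.
move=> y y0; rewrite -/a -/(phi y).
pose u := `|y - m| / d; have u0 : 0 <= u by rewrite divr_ge0// ltW.
have uE : ((y - m) / d) ^+ 2 = u ^+ 2 by rewrite /u !expr_div_n real_normK// num_real.
have ud : `|y - m| = u * d by rewrite /u divfK// gt_eqF.
pose J := Num.truncn u; have /andP[Ju uJ] := truncn_itv u0.
rewrite -/J in Ju uJ; rewrite -natr1 in uJ.
(* Enough because J <= u and 4 (1 + J^2) - (2 + 4 J + J^2) = 2 (J - 1)^2 + J^2 >= 0. *)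
suff : `|phi y| <= (2 + 4 * J%:R + J%:R ^+ 2) * w.
  move=> /le_trans; apply; rewrite uE mulrAC ler_wpM2r//.
  have J0 : 0 <= J%:R :> R by [].
  have := sqr_ge0 (J%:R - 1 : R); have : J%:R ^+ 2 <= u ^+ 2 by rewrite lerXn2r.
  by nra.
have [ym|/ltW ym] := leP m y.
  rewrite ger0_norm ?subr_ge0// in ud.
  have -> : phi y = phi (y - J%:R * d + J%:R * d) by rewrite subrK.
  have y01 : m <= y - J%:R * d <= m + d by apply/andP; split; nra.
  apply: (@second_difference_growth _ (fun j => phi (y - J%:R * d + j%:R * d))) => //.
  - by rewrite mul0r addr0 (le_trans (phi01 _ y01))//; lra.
  - move=> _; rewrite mul1r mul0r addr0.
    have := phi01 _ y01; have := phi12 (y - J%:R * d + d) ltac:(lra).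
    rewrite !ler_norml => /andP[? ?] /andP[? ?]; apply/andP; split; lra.
  - move=> j _; have /andP[? _] := y01.
    have := phi2 (y - J%:R * d + j%:R * d) d; rewrite d0 lexx => /(_ _ isT).
    rewrite /= -(natr1 j.+1) -(natr1 j); set z := (y - _).
    have j0 : 0 <= j%:R * d by rewrite mulr_ge0// ltW.
    rewrite (_ : z + (j%:R + 1 + 1) * d = z + j%:R * d + 2 * d); last by ring.
    rewrite (_ : z + (j%:R + 1) * d = z + j%:R * d + d); last by ring.
    by apply; rewrite /z; lra.
rewrite ler0_norm ?subr_le0// in ud.
have -> : phi y = phi (y + J%:R * d - J%:R * d) by rewrite addrK.
have y01 : m - d <= y + J%:R * d <= m by apply/andP; split; nra.
have z0 : 0 <= y + J%:R * d by rewrite addr_ge0// mulr_ge0// ltW.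
apply: (@second_difference_growth _ (fun j => phi (y + J%:R * d - j%:R * d))) => //.
- by rewrite mul0r subr0 phiN.
(* The increment phi (z - d) - phi z is a second difference plus phi z - phi (z + d), hence at most
   w + 2 w + w: the 4 of [second_difference_growth] comes from here. J >= 1 keeps z - d
   non-negative. *)
- move=> J0; rewrite mul1r mul0r subr0; set z := y + _ in y01 z0 *.
  have zd : 0 <= z - d.
    have : d <= J%:R * d by rewrite ler_peMl ?ler1n ?(ltW d0).
    by rewrite /z; lra.
  have := phi01 (z + d) ltac:(lra); have := phiN z z0 y01.
  have := phi2 (z - d) d zd; rewrite d0 lexx => /(_ isT).
  rewrite (_ : z - d + 2 * d = z + d); last by ring.
  rewrite (_ : z - d + d = z); last by ring.
  by rewrite !ler_norml => /andP[? ?] /andP[? ?] /andP[? ?]; apply/andP; split; lra.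
- move=> j jJ; have /andP[_ ?] := y01.
  have := phi2 (y + J%:R * d - j.+2%:R * d) d; rewrite d0 lexx => /(_ _ isT).
  have jJd : 0 <= (J%:R - j.+2%:R) * d by rewrite mulr_ge0 ?(ltW d0)// subr_ge0 ler_nat.
  rewrite /= -(natr1 j.+1) -(natr1 j) in jJd *; set z := y + _.
  rewrite (_ : z - (j%:R + 1 + 1) * d + 2 * d = z - j%:R * d); last by ring.
  rewrite (_ : z - (j%:R + 1 + 1) * d + d = z - (j%:R + 1) * d); last by ring.
  by move=> /(_ ltac:(rewrite /z; lra)); congr (`|_| <= _); ring.
Qed.

(** * The beta prime weight and its integrals *)

(* Unnormalised beta prime density with parameters a + 1 and b + 1. *)
Definition bprime {R : realType} (a b : nat) (s : R) : R :=
  s ^+ a / (1 + s) ^+ (a + b + 2).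

Lemma bprime_ge0 (R : realType) (a b : nat) (s : R) : 0 <= s -> 0 <= bprime a b s.
Proof. by move=> s0; rewrite divr_ge0// exprn_ge0// addr_ge0. Qed.

(** A factor s, coming from a moment or from the chain rule on g (x s), trades one unit of b for one
    unit of a, so all later integrals stay in this family. *)
Lemma bprimeS (R : realType) (a b : nat) (s : R) : s * bprime a b.+1 s = bprime a.+1 b s.
Proof. by rewrite /bprime mulrA -exprS addSnnS. Qed.

(* Pascal-type recursion, by which the beta integral is computed from b = 0. *)
Lemma bprimeD (R : realType) (a b : nat) (s : R) : 0 <= s ->
  bprime a b s = bprime a b.+1 s + bprime a.+1 b s.
Proof.
move=> s0; rewrite -bprimeS /bprime (_ : a + b.+1 + 2 = (a + b + 2).+1)%N ?exprS; last lia.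
have s1 : (1 + s != 0) by rewrite gt_eqF// ltr_wpDr.
by field; rewrite s1 expf_neq0.
Qed.

Lemma continuous_bprime (R : realType) (a b : nat) :
  {within `[0, +oo[, continuous (@bprime R a b)}.
Proof.
apply: derivable_within_continuous => s; rewrite in_itv/= andbT => s0.
apply: derivableM; first exact: exprn_derivable.
apply: derivableV; first by rewrite expf_neq0// gt_eqF// ltr_wpDr.
rewrite -exprfctE; apply: derivableX.
by apply: derivableD; [exact: derivable_cst|exact: derivable_id].
Qed.

(** The antiderivative is (s / (1 + s))^(a+1) / (a + 1), written through 1 - 1 / (1 + s) to make its
    derivative and its limit at infinity easy to read off. *)
Lemma integral_bprime0 (R : realType) (a : nat) :
  (\int[lebesgue_measure]_(s in `[0%R, +oo[) (bprime a 0 s)%:E)%E = (a.+1%:R^-1 : R)%:E.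
Proof.
pose F (s : R) := (1 - (1 + s)^-1) ^+ a.+1 / a.+1%:R.
have dF (s : R) : 0 <= s -> is_derive s 1 F (bprime a 0 s).
  move=> s0; have s1 : 1 + s != 0 by rewrite gt_eqF// ltr_wpDr.
  have d1 : is_derive s 1 (fun s => 1 - (1 + s)^-1) ((1 + s) ^- 2).
    have dD := is_deriveD (is_derive_cst (1 : R) s 1) (is_derive_id s 1).
    have dV := @is_deriveV R (fun t => 1 + t) s _ 1 s1 dD.
    have := is_deriveB (is_derive_cst (1 : R) s 1) dV.
    by rewrite !add0r /GRing.scale/= mulr1 opprK.
  have := is_deriveX a.+1 d1; rewrite exprfctE => dX.
  have := is_deriveM dX (is_derive_cst (a.+1%:R^-1 : R) s 1).
  rewrite scaler0 add0r; congr is_derive.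
  rewrite /bprime addn0 addn2 !exprS.
  rewrite (_ : 1 - (1 + s)^-1 = s / (1 + s)); last by field.
  rewrite expr_div_n.
  by rewrite /GRing.scale/=; field; rewrite s1 expf_neq0//= natr1 pnatr_eq0.
rewrite (@ge0_continuous_FTC2y _ _ F 0 a.+1%:R^-1).
- by rewrite /F addr0 invr1 subrr expr0n mul0r sube0.
- by move=> s s0; exact: bprime_ge0.
- exact: continuous_bprime.
- rewrite -[X in _ --> X]mul1r; apply: cvgMl; rewrite -[X in _ --> X](expr1n _ a.+1).
  have c1 : (1 - (1 + s)^-1) @[s --> +oo] --> (1 : R).
    rewrite -[X in _ --> X]subr0; apply: cvgB; first exact: cvg_cst.
    apply/gtr0_cvgV0; last exact: cvg_addrl.
    near=> x; rewrite addr_gt0//; near: x; exact: nbhs_pinfty_gt.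
  exact: (cvg_comp _ _ c1 (@exprn_continuous R a.+1 1)).
- by move=> s /ltW s0; have [] := dF s s0.
- apply: cvg_at_right_filter; apply: differentiable_continuous.
  by apply/derivable1_diffP; have [] := dF 0 (lexx _).
- move=> s; rewrite in_itv/= andbT => /ltW s0.
  by rewrite derive1E; have [_ ->] := dF s s0.
Unshelve. all: by end_near.
Qed.

(** Induction on b for all a at once: by [bprimeD], the integral at (a, b + 1) is the one at (a, b)
    minus the one at (a + 1, b). Both are finite by induction, so the subtraction is legitimate in
    the extended reals. *)
Lemma integral_bprime (R : realType) (a b : nat) :
  (\int[lebesgue_measure]_(s in `[0%R, +oo[) (bprime a b s)%:E)%E
   = ((a`! * b`!)%:R / (a + b + 1)`!%:R : R)%:E.
Proof.
have mb c d : measurable_fun (`[0, +oo[ : set (measurableTypeR R)) (fun s => (bprime c d s)%:E).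
  apply/measurable_EFinP; apply: subspace_continuous_measurable_fun => //.
  exact: continuous_bprime.
elim: b a => [|b IH] a.
  rewrite integral_bprime0 addn0 addn1 fact0 muln1 factS natrM; congr (_%:E).
  by field; rewrite nat1r !pnatr_eq0 -lt0n fact_gt0.
have := IH a.
under eq_integral.
  move=> s; rewrite inE/= in_itv/= andbT => s0.
  rewrite bprimeD// EFinD; over.
rewrite ge0_integralD//=;
  [|by move=> s; rewrite in_itv/= andbT => s0; rewrite lee_fin bprime_ge0..].
rewrite IH => /(congr1 (fun x => x - ((a.+1`! * b`!)%:R / (a.+1 + b + 1)`!%:R)%:E)%E).
rewrite addeK// -EFinB => ->; congr (_%:E).
rewrite !addn1 addSn addnS !factS !natrM.
have : (a + b)`!%:R != 0 :> R by rewrite pnatr_eq0 -lt0n fact_gt0.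
have : a`!%:R != 0 :> R by rewrite pnatr_eq0 -lt0n fact_gt0.
have : b`!%:R != 0 :> R by rewrite pnatr_eq0 -lt0n fact_gt0.
rewrite -!natr1 !natrD => b0 a0 ab0; field.
by rewrite ab0 -!natrD !natr1 !pnatr_eq0.
Qed.

Lemma integrable_bprime (R : realType) (a b : nat) :
  lebesgue_measure.-integrable `[0, +oo[ (EFin \o @bprime R a b).
Proof.
apply/integrableP; split.
  apply/measurable_EFinP; apply: subspace_continuous_measurable_fun => //.
  exact: continuous_bprime.
under eq_integral.
  move=> s; rewrite inE/= in_itv/= andbT => s0.
  rewrite ger0_norm ?bprime_ge0//; over.
by rewrite integral_bprime ltry.
Qed.

Lemma Rintegral_bprime (R : realType) (a b : nat) :
  \int[lebesgue_measure]_(s in `[0, +oo[) bprime a b s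
   = (a`! * b`!)%:R / (a + b + 1)`!%:R :> R.
Proof. by rewrite /Rintegral integral_bprime. Qed.

Lemma integrable_bprimeM (R : realType) (a b : nat) (g : R -> R) (B : R) :
  {within `[0, +oo[, continuous g} -> (forall y, 0 <= y -> `|g y| <= B) ->
  lebesgue_measure.-integrable `[0, +oo[ (EFin \o (fun s => bprime a b s * g s)).
Proof.
move=> gc gB.
rewrite (_ : EFin \o _ = (EFin \o bprime a b) \* (EFin \o g))%E//.
apply: integrableMl => //.
- exact: integrable_bprime.
- exact: subspace_continuous_measurable_fun.
- exists B; split; first exact: num_real.
  move=> C BC s /=; rewrite in_itv/= andbT => s0.
  by rewrite (le_trans (gB _ s0))// ltW.
Qed.

(** * Derivatives of the operator as beta prime integrals *)

(** The substitution t = x s is made for non-negative functions, then applied to the positive and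
    negative parts of F, which remain continuous; the factor x > 0 passes through the maximum with
    0. *)
Lemma Rintegral_scale (R : realType) (F : R -> R) (x : R) : 0 < x ->
  {within `[0, +oo[, continuous F} ->
  \int[lebesgue_measure]_(t in `[0, +oo[) F t =
  \int[lebesgue_measure]_(s in `[0, +oo[) (F (x * s) * x).
Proof.
move=> x0 cF.
have ge0_scale (G : R -> R) : {within `[0, +oo[, continuous G} -> (forall t, 0 <= G t) ->
  (\int[lebesgue_measure]_(t in `[0%R, +oo[) (G t)%:E =
   \int[lebesgue_measure]_(s in `[0%R, +oo[) (G (x * s) * x)%:E)%E.
  move=> cG G0.
  have dx : (( *%R x)^`())%classic = cst x.
    apply/funext => s; rewrite derive1E.
    by apply: derive_val; apply: is_derive_eq; rewrite /GRing.scale/= mulr1.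
  have := @increasing_ge0_integration_by_substitutiony _ ( *%R x) G 0.
  rewrite mulr0 => ->.
  - by apply: eq_integral => s _; rewrite dx.
  - by move=> s t _ _; rewrite ltr_pM2l.
  - by rewrite dx => s _; exact: cst_continuous.
  - by rewrite dx; exact: is_cvg_cst.
  - by rewrite dx; exact: is_cvg_cst.
  - split; first by move=> s _; exact: ex_derive.
    by apply: cvg_at_right_filter; apply: cvgMr; exact: cvg_id.
  - exact: gt0_cvgMry.
  - by [].
  - by move=> s _; exact: G0.
have cmax (G : R -> R) : {within `[0, +oo[, continuous G} ->
    {within `[0, +oo[, continuous (fun t => Num.max (G t) 0)}.
  by move=> cG t; apply: continuous_max; [exact: cG|exact: cst_continuous].
rewrite /Rintegral integralE [in RHS]integralE; congr (fine (_ - _)).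
- rewrite funerpos ge0_scale//; last exact: cmax.
  apply: eq_integral => s _; rewrite funerpos /funrpos/=.
  by rewrite maxr_pMl ?mul0r// ltW.
- rewrite funerneg ge0_scale//; last by apply: cmax => t; apply: continuousN; exact: cF.
  apply: eq_integral => s _; rewrite funerneg /funrneg/=.
  by rewrite maxr_pMl ?mul0r ?mulNr// ltW.
Qed.

Lemma within_continuous_scale (R : realType) (g : R -> R) (x : R) : 0 <= x ->
  {within `[0, +oo[, continuous g} -> {within `[0, +oo[, continuous (fun s => g (x * s))}.
Proof.
move=> x0 /subspace_continuousP cg; apply/subspace_continuousP => z z0.
have xz0 : `[0, +oo[%classic (x * z).
  by move: z0; rewrite /= !in_itv/= !andbT => z0; rewrite mulr_ge0.
move=> U /(cg _ xz0) HU.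
have HW : nbhs z [set s | `[0, +oo[%classic (x * s) -> U (g (x * s))] :=
  @mulrl_continuous _ x z _ HU.
suff : nbhs z [set s | `[0, +oo[%classic s -> U (g (x * s))] by [].
apply: filterS HW => s/= xsU s0; apply: xsU.
by move: s0; rewrite /= !in_itv/= !andbT => s0; rewrite mulr_ge0.
Qed.

(** At an interior point the constraint 0 <= h + x holds for all small h, so the restricted filter
    is the usual punctured one. *)
Lemma is_derive_half (R : realType) (g : R -> R) (x : R) : 0 < x ->
  half_derivable g x -> is_derive x 1 g (half_derive g x).
Proof.
move=> x0; rewrite /half_derivable /half_derive.
have -> : within [set h | 0 <= h + x] (0^') = 0^'.
  apply/seteqP; split => U/=; rewrite /within/=; last by apply: filterS => h ? _.
  have : \forall h \near 0^', 0 <= h + x.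
    apply: nbhs_dnbhs; near=> h; rewrite -lerBlDr sub0r ltW//; near: h.
    by apply: lt_nbhsr; rewrite oppr_lt0.
  by move=> h1 h2; apply: filterS2 h1 h2 => h h1 /(_ h1).
move=> gx; have dg : derivable g x 1.
  by rewrite /derivable; under eq_fun do rewrite scaler1.
by apply: DeriveDef => //; rewrite -derive1E.
Unshelve. all: by end_near.
Qed.

(** Differentiation under the integral sign: the chain rule produces a factor s, absorbed by
    [bprimeS], and B times the new weight dominates the derivative uniformly in z. *)
Lemma is_derive_bprime_integral (R : realType) (g : R -> R) (B : R) (a b : nat) (x : R) :
  {within `[0, +oo[, continuous g} -> (forall y, 0 <= y -> `|g y| <= B) ->
  (forall y, 0 <= y -> `|half_derive g y| <= B) ->
  (forall y, 0 <= y -> half_derivable g y) -> 0 < x ->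
  is_derive x 1
    (fun z => \int[lebesgue_measure]_(s in `[0, +oo[) (bprime a b.+1 s * g (z * s)))
    (\int[lebesgue_measure]_(s in `[0, +oo[) (bprime a.+1 b s * half_derive g (x * s))).
Proof.
move=> cg gB dgB dg x0.
have xI : `]0, x + 1[%classic x by rewrite /= in_itv/= x0 ltrDl ltr01.
have intf z : `]0, x + 1[%classic z ->
    lebesgue_measure.-integrable `[0, +oo[ (EFin \o (fun s => bprime a b.+1 s * g (z * s))).
  rewrite /= in_itv/= => /andP[/ltW z0 _]; apply: (@integrable_bprimeM _ _ _ _ B).
    exact: within_continuous_scale.
  by move=> y y0; rewrite gB// mulr_ge0.
have df (z s : R) : `]0, x + 1[%classic z -> `[0, +oo[%classic s ->
    is_derive z 1 (fun z => bprime a b.+1 s * g (z * s)) (bprime a.+1 b s * half_derive g (z * s)).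
  (* At s = 0 the point z s is the endpoint 0, where g has only a one-sided derivative; but the
     integrand is then constant in z, and the claimed derivative vanishes with its factor s. *)
  rewrite /= !in_itv/= andbT => /andP[z0 _]; rewrite le_eqVlt => /predU1P[<-|s0].
    rewrite -bprimeS !mul0r; under eq_fun do rewrite mulr0.
    exact: is_derive_cst.
  have zs0 : 0 < z * s by rewrite mulr_gt0.
  have dgz := is_derive_half zs0 (dg _ (ltW zs0)).
  have dmul : is_derive z 1 (fun t => t * s) s.
    have := is_deriveM (is_derive_id z (1 : R)) (is_derive_cst s z 1).
    by rewrite scaler0 add0r /GRing.scale/= mulr1.
  have := is_deriveZ (bprime a b.+1 s) (@is_derive1_comp _ g (fun t => t * s) z _ _ dgz dmul).
  by rewrite -bprimeS /GRing.scale/= => H; apply: is_derive_eq H _; ring.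
pose G s := B * `|bprime a.+1 b s| : R.
have G0 s : 0 <= G s.
  by rewrite mulr_ge0// (le_trans _ (gB 0 (lexx _))).
have intG : lebesgue_measure.-integrable `[0, +oo[ (EFin \o G).
  rewrite (_ : EFin \o G = fun s => B%:E * `|(EFin \o bprime a.+1 b) s|)%E//.
  by apply: integrableZl => //; apply: integrable_abse; exact: integrable_bprime.
have GB (z s : R) : `]0, x + 1[%classic z -> `[0, +oo[%classic s ->
    `|partial1of2 (fun z s => bprime a b.+1 s * g (z * s)) z s| <= G s.
  move=> zI sI; rewrite /partial1of2 derive1E; have [_ ->] := df z s zI sI.
  rewrite normrM mulrC ler_wpM2r// dgB//.
  move: zI sI; rewrite /= !in_itv/= andbT => /andP[/ltW z0 _] s0.
  by rewrite mulr_ge0.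
have derf (z s : R) : `]0, x + 1[%classic z -> `[0, +oo[%classic s ->
    derivable (fun z : R => bprime a b.+1 s * g (z * s)) z 1.
  by move=> zI sI; have [] := df z s zI sI.
apply: DeriveDef; first exact: (derivable_under_integral _ xI intf derf G0 intG GB).
rewrite -derive1E (differentiation_under_integral _ xI intf derf G0 intG GB)//.
apply: eq_Rintegral => s; rewrite inE => sI.
by rewrite /partial1of2 derive1E; have [_ ->] := df x s xI sI.
Qed.

(** After t = x s the powers of x combine to x^-(n+1), which cancels the prefactor of the
    operator. *)
Lemma gammaopE (R : realType) (n k : nat) (f : R -> R) (x : R) : (k <= n)%N ->
  CB f -> 0 < x ->
  gammaop n k f x = (2 * n - k + 1)`!%:R / (n`!%:R * (n - k)`!%:R) *
    \int[lebesgue_measure]_(s in `[0, +oo[) (bprime (n - k) n s * f (x * s)).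
Proof.
move=> kn [cf [B fB]] x0; rewrite /gammaop.
have cw : {within `[0, +oo[, continuous
    (fun t => t ^+ (n - k) / (x + t) ^+ (2 * n - k + 2) * f t)}.
  have cK : {within `[0, +oo[, continuous (fun t => t ^+ (n - k) / (x + t) ^+ (2 * n - k + 2))}.
    apply: derivable_within_continuous => s; rewrite in_itv/= andbT => s0.
    apply: derivableM; first exact: exprn_derivable.
    apply: derivableV; first by rewrite expf_neq0// gt_eqF// ltr_wpDr.
    rewrite -exprfctE; apply: derivableX.
    by apply: derivableD; [exact: derivable_cst|exact: derivable_id].
  by move=> t; exact: (continuousM (cK t) (cf t)).
rewrite (Rintegral_scale x0 cw).
have xN : x ^+ n.+1 != 0 by rewrite expf_neq0// gt_eqF.
have -> : \int[lebesgue_measure]_(s in `[0, +oo[)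
     ((x * s) ^+ (n - k) / (x + x * s) ^+ (2 * n - k + 2) * f (x * s) * x) =
   (x ^+ n.+1)^-1 * \int[lebesgue_measure]_(s in `[0, +oo[) (bprime (n - k) n s * f (x * s)).
  rewrite -RintegralZl//; last first.
    apply: (@integrable_bprimeM _ _ _ _ B); first exact/within_continuous_scale/cf/ltW.
    by move=> y y0; rewrite fB// mulr_ge0// ltW.
  apply: eq_Rintegral => s; rewrite inE/= in_itv/= andbT => s0.
  rewrite /bprime -{2}(mulr1 x) -mulrDr !exprMn.
  rewrite (_ : 2 * n - k + 2 = n - k + n + 2)%N; last lia.
  have -> : x ^+ (n - k + n + 2) = x ^+ (n - k) * x ^+ n.+1 * x.
    by rewrite -exprD -exprSr; congr (_ ^+ _); lia.
  have xk : x ^+ (n - k) != 0 by rewrite expf_neq0// gt_eqF.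
  have sk : (1 + s) ^+ (n - k + n + 2) != 0 by rewrite expf_neq0// gt_eqF// ltr_wpDr.
  by field; rewrite xN xk sk gt_eqF.
by rewrite [LHS]mulrA; congr (_ * _); field; rewrite xN !pnatr_eq0 -!lt0n !fact_gt0.
Qed.

(** Each differentiation moves one unit from the second parameter to the first and leaves the
    constant in front unchanged. *)
Lemma derive1n_gammaop (R : realType) (n k r : nat) (f : R -> R) : (k <= n)%N ->
  (r <= n)%N -> CBn r f -> forall x, 0 < x ->
  derive1n r (gammaop n k f) x = (2 * n - k + 1)`!%:R / (n`!%:R * (n - k)`!%:R) *
    \int[lebesgue_measure]_(s in `[0, +oo[)
      (bprime (n - k + r) (n - r) s * half_deriven r f (x * s)).
Proof.
move=> kn; elim: r => [|r IHr] rn [fB fd] x x0.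
  by rewrite derive1n0 addn0 subn0 gammaopE//; exact: (fB 0%N isT).
have IH := IHr (ltnW rn) (conj (fun i ir => fB i (leqW ir)) (fun i ir => fd i (leqW ir))).
have [B0 hB0] := (fB r (leqnSn r)).2; have [B1 hB1] := (fB r.+1 (leqnn _)).2.
rewrite derive1nS derive1E.
set c := _ / _ in IH *.
have := @is_derive_bprime_integral R (half_deriven r f) (Num.max B0 B1) (n - k + r) (n - r.+1) x.
rewrite -subSn// subSS => /(_ (fB r (leqnSn r)).1) H.
have {}H := is_deriveZ c (H _ _ (fd r (ltnSn r)) x0).
(* The induction hypothesis holds only at positive points, so the two functions are identified only
   near x. *)
rewrite (near_eq_derive (g := c \*: (fun z => \int[lebesgue_measure]_(s in `[0, +oo[)
      (bprime (n - k + r) (n - r) s * half_deriven r f (z * s))))).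
  rewrite addnS; apply: derive_val; apply: H.
  - by move=> y y0; rewrite le_max hB0.
  - by move=> y y0; rewrite le_max hB1 ?orbT.
near=> z; apply: IH; near: z; exact: lt_nbhsr.
Unshelve. all: by end_near.
Qed.

(** * Moduli as pointwise bounds, and second differences of arbitrary step *)

(** A real supremum dominates the members only of a bounded set; the uniform B bounds the inner sets
    and the outer one together. *)
Lemma sup_sup_ge (R : realType) (F : R -> R -> R) (B : R) (H : set R) (h y : R) :
  (forall h y, H h -> 0 <= y -> F h y <= B) -> H h -> 0 <= y ->
  F h y <= sup [set sup [set F h y | y in `[0, +oo[] | h in H].
Proof.
move=> FB Hh y0.
have in0 z : 0 <= z -> `[0, +oo[%classic z by rewrite /= in_itv/= andbT.
have FBsup k : H k -> sup [set F k y | y in `[0, +oo[] <= B.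
  move=> Hk; apply: ge_sup; first by exists (F k y), y => //; exact: in0.
  by move=> _ [z /= + <-]; rewrite in_itv/= andbT => z0; exact: FB.
apply: (@le_trans _ _ (sup [set F h y | y in `[0, +oo[])).
  apply: sup_upper_bound; last by exists y => //; exact: in0.
  split; first by exists (F h y), y => //; exact: in0.
  by exists B => _ [z /= + <-]; rewrite in_itv/= andbT => z0; exact: FB.
apply: sup_upper_bound; last by exists h.
split; first by exists (sup [set F h y | y in `[0, +oo[]), h.
by exists B => _ [k Hk <-]; exact: FBsup.
Qed.

Lemma omega_ge (R : realType) (g : R -> R) (B y h delta : R) :
  (forall y, 0 <= y -> `|g y| <= B) -> 0 <= y -> 0 < h <= delta ->
  `|g (y + h) - g y| <= omega g delta.
Proof.
move=> gB y0 hd.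
apply: (@sup_sup_ge _ (fun h y => `|g (y + h) - g y|) (B + B)) => // k z /= /andP[/ltW k0 _] z0.
by rewrite (le_trans (ler_normB _ _))// lerD// gB// addr_ge0.
Qed.

Lemma omega2_ge (R : realType) (g : R -> R) (B y h : R) (delta : \bar R) :
  (forall y, 0 <= y -> `|g y| <= B) -> 0 <= y -> 0 < h -> (h%:E <= delta)%E ->
  `|g (y + 2 * h) - 2 * g (y + h) + g y| <= omega2 g delta.
Proof.
move=> gB y0 h0 hd.
apply: (@sup_sup_ge _ (fun h y => `|g (y + 2 * h) - 2 * g (y + h) + g y|) (4 * B)) => //.
move=> k z /= [k0 _] z0.
have := gB (z + 2 * k) ltac:(lra); have := gB (z + k) ltac:(lra); have := gB z z0.
rewrite !ler_norml => /andP[? ?] /andP[? ?] /andP[? ?]; apply/andP; split; lra.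
Qed.

(** Letting d tend to infinity in [second_difference_affine]: the slope is at most 2 B / d because g
    is bounded, and the quadratic term also vanishes. *)
Lemma second_difference_oscillation (R : realType) (g : R -> R) (B w m y : R) :
  (forall y, 0 <= y -> `|g y| <= B) -> 0 <= m ->
  (forall y h, 0 <= y -> 0 < h -> `|g (y + 2 * h) - 2 * g (y + h) + g y| <= w) ->
  0 <= y -> `|g y - g m| <= 4 * w.
Proof.
move=> gB m0 g2 y0; apply/ler_addgt0Pr => e e0.
have w0 : 0 <= w := le_trans (normr_ge0 _) (g2 0 1 (lexx _) ltr01).
have B0 : 0 <= B := le_trans (normr_ge0 _) (gB 0 (lexx _)).
pose L := `|y - m|; pose M := 2 * B * L + 4 * w * L ^+ 2.
have L0 : 0 <= L by exact: normr_ge0.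
have M0 : 0 <= M by rewrite addr_ge0// !mulr_ge0// exprn_ge0.
(* The summand 1 gives d >= 1, so that 1 / d^2 <= 1 / d and both error terms fit into M / d <= e. *)
pose d := 1 + M / e; have d1 : 1 <= d by rewrite lerDl divr_ge0// ltW.
have d0 : 0 < d by rewrite (lt_le_trans ltr01).
have Md : M / d <= e.
  rewrite ler_pdivrMr// /d mulrDr mulr1 mulrCA divff ?gt_eqF// mulr1.
  by rewrite lerDr ltW.
have := second_difference_affine gB d0 m0 (fun y h y0 hd => g2 y h y0 (andP hd).1) y0.
set al := (g (m + d) - g m) / d => H.
have al_le : `|al * (y - m)| <= 2 * B * L / d.
  rewrite normrM /al normrM normfV (gtr0_norm d0) -/L mulrAC ler_pM2r ?invr_gt0//.
  rewrite ler_wpM2r// (le_trans (ler_normB _ _))//.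
  by have := gB _ m0; have := gB (m + d) ltac:(lra); lra.
have quad : 4 * w * ((y - m) / d) ^+ 2 <= 4 * w * L ^+ 2 / d.
  rewrite -(mulrA (4 * w)) ler_wpM2l ?mulr_ge0// -[_ ^+ 2]ger0_norm ?sqr_ge0//.
  rewrite normrX normrM normfV (gtr0_norm d0) -/L expr_div_n.
  by rewrite ler_wpM2l ?exprn_ge0// lef_pV2 ?posrE ?exprn_gt0// expr2 ler_peMl// ltW.
have -> : g y - g m = (g y - g m - al * (y - m)) + al * (y - m) by ring.
apply: le_trans (ler_normD _ _) _; apply: le_trans (lerD H al_le) _.
suff : M / d = 2 * B * L / d + 4 * w * L ^+ 2 / d by lra.
by rewrite /M mulrDl.
Qed.

(** * Averaging the pointwise bounds against the weight *)

Lemma normr_Rintegral_le (R : realType) (phi U : R -> R) :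
  lebesgue_measure.-integrable `[0, +oo[ (EFin \o phi) ->
  lebesgue_measure.-integrable `[0, +oo[ (EFin \o U) ->
  (forall s, 0 <= s -> `|phi s| <= U s) ->
  `|\int[lebesgue_measure]_(s in `[0, +oo[) phi s| <=
    \int[lebesgue_measure]_(s in `[0, +oo[) U s.
Proof.
move=> iphi iU phiU.
apply: le_trans (le_normr_Rintegral _ iphi) _ => //; apply: le_Rintegral => //.
  by have := integrable_abse iphi.
by move=> s; rewrite /= in_itv/= andbT; exact: phiU.
Qed.

Lemma integrable_EFinZl (d : measure_display) (T : measurableType d) (R : realType)
    (mu : {measure set T -> \bar R}) (D : set T) (c : R) (f : T -> R) :
  measurable D -> mu.-integrable D (EFin \o f) ->
  mu.-integrable D (EFin \o (fun s => c * f s)).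
Proof.
move=> mD mf; rewrite (_ : EFin \o _ = fun s => c%:E * (EFin \o f) s)%E//.
exact: integrableZl.
Qed.

Lemma integrable_EFinD (d : measure_display) (T : measurableType d) (R : realType)
    (mu : {measure set T -> \bar R}) (D : set T) (f g : T -> R) :
  measurable D -> mu.-integrable D (EFin \o f) -> mu.-integrable D (EFin \o g) ->
  mu.-integrable D (EFin \o (fun s => f s + g s)).
Proof.
move=> mD mf mg; rewrite (_ : EFin \o _ = (EFin \o f) \+ (EFin \o g))%E//.
exact: integrableD.
Qed.

(** Serves n = r + 1, where the weight has no second moment and a bound uniform in y is averaged. K
    is the total mass. *)
Lemma bprime_mean_oscillation (R : realType) (g : R -> R) (B c w x K : R) (a b : nat) :
  {within `[0, +oo[, continuous g} -> (forall y, 0 <= y -> `|g y| <= B) -> 0 < x ->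
  (forall y, 0 <= y -> `|g y - c| <= w) ->
  K = \int[lebesgue_measure]_(s in `[0, +oo[) bprime a b s ->
  `|\int[lebesgue_measure]_(s in `[0, +oo[) (bprime a b s * g (x * s)) - K * c| <= w * K.
Proof.
move=> cg gB x0 gc ->.
have iP := @integrable_bprime R a b.
have ig : lebesgue_measure.-integrable `[0, +oo[ (EFin \o (fun s => bprime a b s * g (x * s))).
  apply: (@integrable_bprimeM _ _ _ _ B); first exact/within_continuous_scale/cg/ltW.
  by move=> y y0; rewrite gB// mulr_ge0// ltW.
have iPc : lebesgue_measure.-integrable `[0, +oo[ (EFin \o (fun s => - c * bprime a b s)).
  exact: integrable_EFinZl.
have iPw : lebesgue_measure.-integrable `[0, +oo[ (EFin \o (fun s => w * bprime a b s)).
  exact: integrable_EFinZl.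
rewrite -mulrN (mulrC _ (- c)) -!RintegralZl// -RintegralD//.
apply: normr_Rintegral_le => //.
  exact: integrable_EFinD.
move=> s s0; rewrite (mulrC (- c)) -mulrDr normrM (ger0_norm (bprime_ge0 _ _ s0)) mulrC.
by rewrite ler_wpM2r ?bprime_ge0// gc// mulr_ge0// ltW.
Qed.

(** The form [b.+2] of the second parameter guarantees two moments. As m is the mean, the linear
    term integrates to 0, and the quadratic bound integrates to 4 w (1 + Var / d^2) K, at most 8 w K
    since Var <= d^2. *)
Lemma bprime_mean_affine (R : realType) (g : R -> R) (B w d x K m : R) (a b : nat) :
  {within `[0, +oo[, continuous g} -> (forall y, 0 <= y -> `|g y| <= B) -> 0 < x -> 0 < d ->
  (forall y h, 0 <= y -> 0 < h <= d ->
    `|g (y + 2 * h) - 2 * g (y + h) + g y| <= w) ->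
  K = \int[lebesgue_measure]_(s in `[0, +oo[) bprime a b.+2 s ->
  m = x * (a.+1%:R / b.+2%:R) ->
  x ^+ 2 * (a.+1%:R * a.+2%:R / (b.+2%:R * b.+1%:R)) - m ^+ 2 <= d ^+ 2 ->
  `|\int[lebesgue_measure]_(s in `[0, +oo[) (bprime a b.+2 s * g (x * s)) - K * g m| <= 8 * w * K.
Proof.
move=> cg gB x0 d0 g2 KE mE Vd.
have m0 : 0 <= m by rewrite mE mulr_ge0 ?divr_ge0// ltW.
have w0 : 0 <= w by apply: le_trans (g2 0 d _ _); rewrite ?d0 ?lexx.
have K0 : 0 <= K.
  by rewrite KE; apply: Rintegral_ge0 => s; rewrite /= in_itv/= andbT; exact: bprime_ge0.
have fact_neq0 n : n`!%:R != 0 :> R by rewrite pnatr_eq0 -lt0n fact_gt0.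
have I1 : \int[lebesgue_measure]_(s in `[0, +oo[) bprime a.+1 b.+1 s = K * (a.+1%:R / b.+2%:R).
  rewrite KE !Rintegral_bprime addSnnS !factS !natrM.
  by field; rewrite !fact_neq0 -?natrD ?nat1r ?pnatr_eq0.
have I2 : \int[lebesgue_measure]_(s in `[0, +oo[) bprime a.+2 b s =
    K * (a.+1%:R * a.+2%:R / (b.+2%:R * b.+1%:R)).
  rewrite KE !Rintegral_bprime !addSnnS !factS !natrM.
  by field; rewrite !fact_neq0 -?natrD ?nat1r ?pnatr_eq0.
have iP0 := @integrable_bprime R a b.+2.
have iP1 := @integrable_bprime R a.+1 b.+1.
have iP2 := @integrable_bprime R a.+2 b.
have ig : lebesgue_measure.-integrable `[0, +oo[ (EFin \o (fun s => bprime a b.+2 s * g (x * s))).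
  apply: (@integrable_bprimeM _ _ _ _ B); first exact/within_continuous_scale/cg/ltW.
  by move=> y y0; rewrite gB// mulr_ge0// ltW.
pose al := (g (m + d) - g m) / d.
(* [phi] is the weighted deviation from the affine interpolant and [U] its weighted quadratic bound,
   both expanded over the weights whose integrals are K, [I1] and [I2]. *)
pose phi s := bprime a b.+2 s * g (x * s) +
  (- (g m - al * m) * bprime a b.+2 s + - (al * x) * bprime a.+1 b.+1 s).
pose U s := 4 * w * (1 + m ^+ 2 / d ^+ 2) * bprime a b.+2 s +
  (- (4 * w * 2 * m * x / d ^+ 2) * bprime a.+1 b.+1 s +
   4 * w * x ^+ 2 / d ^+ 2 * bprime a.+2 b s).
have iphi : lebesgue_measure.-integrable `[0, +oo[ (EFin \o phi).
  apply: integrable_EFinD => //; apply: integrable_EFinD => //; exact: integrable_EFinZl.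
have iU : lebesgue_measure.-integrable `[0, +oo[ (EFin \o U).
  apply: integrable_EFinD => //; first exact: integrable_EFinZl.
  by apply: integrable_EFinD => //; exact: integrable_EFinZl.
have phiU s : 0 <= s -> `|phi s| <= U s.
  move=> s0.
  have -> : phi s = bprime a b.+2 s * (g (x * s) - g m - al * (x * s - m)).
    by rewrite /phi -bprimeS; ring.
  have -> : U s = bprime a b.+2 s * (4 * w * (1 + ((x * s - m) / d) ^+ 2)).
    by rewrite /U -!bprimeS; field; rewrite gt_eqF.
  rewrite normrM (ger0_norm (bprime_ge0 _ _ s0)) ler_wpM2l ?bprime_ge0//.
  apply: (second_difference_affine gB d0 m0 g2).
  by rewrite mulr_ge0// ltW.
have := normr_Rintegral_le iphi iU phiU.
rewrite /phi /U !RintegralD ?RintegralZl//;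
  do ?by [exact: integrable_EFinZl|apply: integrable_EFinD => //; exact: integrable_EFinZl].
rewrite -KE I1 I2 => H.
have Vm : (x ^+ 2 * (a.+1%:R * a.+2%:R / (b.+2%:R * b.+1%:R)) - m ^+ 2) / d ^+ 2 <= 1.
  by rewrite ler_pdivrMr ?exprn_gt0// mul1r.
apply: le_trans (le_trans H _).
  rewrite le_eqVlt; apply/orP; left; apply/eqP; congr `|_|.
  by rewrite {3}mE; ring.
set V := x ^+ 2 * _ in Vm.
have -> : 4 * w * (1 + m ^+ 2 / d ^+ 2) * K +
    (- (4 * w * 2 * m * x / d ^+ 2) * (K * (a.+1%:R / b.+2%:R)) +
     4 * w * x ^+ 2 / d ^+ 2 * (K * (a.+1%:R * a.+2%:R / (b.+2%:R * b.+1%:R)))) =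
    4 * w * (1 + (V - m ^+ 2) / d ^+ 2) * K.
  have e1 : x * (a.+1%:R / b.+2%:R) = m by rewrite mE.
  transitivity (4 * w * (1 + m ^+ 2 / d ^+ 2) * K +
    (- (4 * w * 2 * m / d ^+ 2) * (K * (x * (a.+1%:R / b.+2%:R))) +
     4 * w / d ^+ 2 * (K * V))); first by rewrite /V; ring.
  by rewrite e1; ring.
rewrite ler_wpM2r// (_ : 8 * w = 4 * w * (1 + 1)); last by ring.
by rewrite ler_wpM2l ?mulr_ge0// lerD2l.
Qed.

Lemma omega_shift (R : realType) (g : R -> R) (B x t : R) :
  (forall y, 0 <= y -> `|g y| <= B) -> 0 <= x -> 0 <= x + t ->
  `|g (x + t) - g x| <= omega g `|t|.
Proof.
move=> gB x0 xt0; have [t0|t0|t0] := ltgtP t 0.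
- have := @omega_ge _ g B (x + t) (- t) `|t| gB xt0.
  by rewrite addrK distrC; apply; rewrite ltr0_norm// oppr_gt0 t0 lexx.
- by apply: (@omega_ge _ g B) => //; rewrite gtr0_norm// t0 lexx.
(* No step h satisfies 0 < h <= 0: the modulus is the supremum of the empty set, namely 0. *)
- rewrite t0 addr0 subrr !normr0 /omega (_ : [set _ | _ in _] = set0) ?sup0//.
  by apply/seteqP; split => // ? [h /= /andP[h0 /(lt_le_trans h0)]]; rewrite ltxx.
Qed.

(** * Identification of gamma_n and conclusion *)

(** Divided by b (b - 1), the right-hand side is E (S - 1)^2 = E S^2 - 2 E S + 1 for the beta prime
    variable S; hence gamma_n^2 is E (Y - x)^2 + drift^2. At b = 1 only (a + 1) (a + 2) > 0
    survives. *)
Lemma gamma_numE (R : realType) (n k r a b : nat) : n = (r + b)%N -> (a + k = n + r)%N ->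
  gamma_num n k r = a.+1%:R * a.+2%:R - 2 * a.+1%:R * (b%:R - 1) + b%:R * (b%:R - 1) :> R.
Proof.
move=> nE /(congr1 (fun m => m%:R : R)); rewrite nE !natrD => akE.
rewrite /gamma_num -(natr1 a.+1) -(natr1 a) natrD.
have -> : a%:R = r%:R + b%:R + r%:R - k%:R :> R by rewrite -akE addrK.
by ring.
Qed.

Theorem theorem3 (R : realType) :
  exists2 C : R, 0 < C &
    forall (r : nat) (f : R -> R), CBn r f ->
    forall n k : nat, (0 < k)%N -> (k <= n)%N -> (r < n)%N ->
    forall x : R, 0 < x ->
      `| (bcoef n k r)^-1 * derive1n r (gammaop n k f) x - half_deriven r f x |
      <= C * omega2 (half_deriven r f) (gamman n k r x)
         + omega (half_deriven r f) `| drift n k r x |.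
Proof.
exists 8 => // r f fCB n k _ kn rn x x0.
rewrite (derive1n_gammaop kn (ltnW rn) fCB x0).
have [cg [B gB]] := fCB.1 r (leqnn r).
set g := half_deriven r f in cg gB *.
set a := (n - k + r)%N; set w := omega2 g _.
pose K := \int[lebesgue_measure]_(s in `[0, +oo[) (bprime a (n - r) s) : R.
have fact_gt0R m : 0 < m`!%:R :> R by rewrite ltr0n fact_gt0.
have K0 : 0 < K.
  by rewrite /K Rintegral_bprime natrM divr_gt0// mulr_gt0.
rewrite mulrA.
(* Division by [bcoef] turns the constant into the inverse of the total mass, so the operator
   becomes an average. *)
have -> : (bcoef n k r)^-1 * ((2 * n - k + 1)`!%:R / (n`!%:R * (n - k)`!%:R)) = K^-1.
  rewrite /K Rintegral_bprime /bcoef /a natrM.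
  rewrite (_ : n - k + r + (n - r) + 1 = 2 * n - k + 1)%N; last lia.
  by field; rewrite !gt_eqF.
pose m := x + drift n k r x.
have bR : n%:R - r%:R = (n - r)%:R :> R by rewrite natrB// ltnW.
have b0 : 0 < (n - r)%:R :> R by rewrite ltr0n subn_gt0.
have mE : m = x * (a.+1%:R / (n - r)%:R).
  rewrite /m /drift bR /a -(natr1 (n - k + r)) natrD (natrB _ kn).
  have -> : n%:R = (n - r)%:R + r%:R :> R by rewrite -bR subrK.
  by field; rewrite gt_eqF.
have m0 : 0 <= m by rewrite mE mulr_ge0 ?divr_ge0// ltW.
have -> : K^-1 * \int[lebesgue_measure]_(s in `[0, +oo[) (bprime a (n - r) s * g (x * s)) - g x =
    K^-1 * (\int[lebesgue_measure]_(s in `[0, +oo[) (bprime a (n - r) s * g (x * s)) - K * g m) +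
    (g m - g x) by field; rewrite gt_eqF.
apply: le_trans (ler_normD _ _) (lerD _ (omega_shift gB (ltW x0) m0)).
rewrite normrM gtr0_norm ?invr_gt0// mulrC ler_pdivrMr//.
(* For n = r + 1, gamma_n is infinite and [omega2] controls second differences of every step. *)
have [b1|b1] := eqVneq (n - r)%N 1.
  have gammay : gamman n k r x = +oo%E.
    rewrite /gamman bR b1 subrr mulr0 inve0 (@gamma_numE _ n k r a 1); [|rewrite /a; lia..].
    rewrite subrr !mulr0 subr0 addr0.
    by rewrite gt0_muley ?lte_fin ?mulr_gt0// gt0_mulye ?lte_fin ?exprn_gt0.
  have w2 y h : 0 <= y -> 0 < h -> `|g (y + 2 * h) - 2 * g (y + h) + g y| <= w.
    by move=> y0 h0; apply: (omega2_ge gB) => //; rewrite gammay leey.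
  have w0 : 0 <= w := le_trans (normr_ge0 _) (w2 0 1 (lexx _) ltr01).
  apply: le_trans (_ : 4 * w * K <= _); last by rewrite ler_wpM2r ?(ltW K0)// ler_wpM2r// ler_nat.
  apply: (bprime_mean_oscillation cg gB x0) => // y y0.
  exact: (second_difference_oscillation gB m0 w2).
have [b bE] : exists b, (n - r = b.+2)%N by exists (n - r).-2; lia.
pose V : R := x ^+ 2 * (a.+1%:R * a.+2%:R / (b.+2%:R * b.+1%:R)).
pose D2 := V - m ^+ 2 + 2 * drift n k r x ^+ 2.
have mdrift : drift n k r x = m - x by rewrite /m addrAC subrr add0r.
have mE' : m = x * (a.+1%:R / b.+2%:R) by rewrite mE bE.
(* This closed form shows that the variance is positive, hence gamma_n > 0 even when the drift
   vanishes, and it can serve as the step d. *)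
have VmE : V - m ^+ 2 = x ^+ 2 * (a.+1%:R * (a%:R + b%:R + 3) / (b.+2%:R ^+ 2 * b.+1%:R)).
  rewrite mE' /V; field.
  by rewrite -?natrD ?nat1r ?pnatr_eq0.
have Vm0 : 0 < V - m ^+ 2.
  by rewrite VmE mulr_gt0 ?exprn_gt0// divr_gt0// mulr_gt0// ?exprn_gt0// ltr_wpDl// addr_ge0.
have D20 : 0 < D2 by rewrite ltr_wpDr// mulr_ge0// sqr_ge0.
have gammaE : gamman n k r x = (Num.sqrt D2)%:E.
  rewrite /gamman bR bE (@gamma_numE _ n k r a b.+2); [|rewrite /a; lia..].
  have -> : b.+2%:R - 1 = b.+1%:R :> R by rewrite -natr1 addrK.
  rewrite inver mulf_eq0 !pnatr_eq0/=; congr (Num.sqrt _)%:E.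
  rewrite /D2 /V mdrift mE'; field.
  by rewrite -?natrD ?nat1r ?pnatr_eq0.
rewrite /K bE; apply: (@bprime_mean_affine _ _ _ _ (Num.sqrt D2) _ _ _ _ _ cg gB x0 _ _ erefl mE' _).
- by rewrite sqrtr_gt0; exact: D20.
- by move=> y h y0 /andP[h0 hd]; apply: (omega2_ge gB) => //; rewrite gammaE lee_fin.
(* gamma_n^2 exceeds the variance by 2 drift^2. *)
- rewrite sqr_sqrtr ?(ltW D20)// -/V /D2 lerDl.
  by rewrite mulr_ge0// sqr_ge0.
Qed.
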